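(* Let $x_1,\ldots,x_m$ be distinct points in the open left half plane, closed under complex conjugation and ordered so that $\operatorname{Im}(x_j)>0$ implies $x_{j+1}=\overline{x_j}$. Let $\eta(s)=\prod_{j=1}^m(s-x_j)$ and $\phi_j(s)=\prod_{k\neq j}(s-x_k)$, $j=1,\ldots,m$. Let $V\subset\mathbb{C}^m$ be the real vector space of conjugation-compatible vectors. Let $K_o$ be the set of all $\gamma=(\gamma_1,\ldots,\gamma_m)\in V$ with $\sum_{j=1}^m\gamma_j=1$ such that $$\Delta_o(s)=\Big(\sum_{j=1}^m\frac{\gamma_j}{s-x_j}\Big)^{-1}$$ is strictly positive real, and let $K_1$ be the set of all $c=(c_1,\ldots,c_m)\in V$ such that $$\Delta_1(s)=\Big(1+\sum_{j=1}^m\frac{c_j}{s-x_j}\Big)^{-1}$$ is strictly positive real. Let $A_o=\{\gamma\in K_o:\gamma_1\cdots\gamma_m\neq 0\}$ and $A_1=\{c\in K_1: c_1\cdots c_m\neq 0\}$ be the sets of admissible coefficients. Then: (1) $A_o$ and $A_1$ are nonempty. The polynomials $d_o(s)=\sum_{j=1}^m\gamma_j\phi_j(s)$ with $\gamma\in A_o$ are exactly the monic real polynomials $d$ of degree $m-1$, not vanishing at $x_1,\ldots,x_m$, for which $\eta/d$ is strictly positive real; and the polynomials $d_1(s)=\eta(s)+\sum_{j=1}^m c_j\phi_j(s)$ with $c\in A_1$ are exactly the monic real polynomials $d$ of degree $m$, not vanishing at $x_1,\ldots,x_m$, for which $\eta/d$ is strictly positive real. (2) $K_o$ is a convex set contained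 in the hyperplane $\sum_{j=1}^m\gamma_j=1$ of $\mathbb{C}^m$; thus $A_o$ is a convex set with the points having some $\gamma_j=0$ excluded. (3) $K_1$ is a convex subset of $\mathbb{C}^m$; thus $A_1$ is a convex set with the $m$ hyperplanes $c_j=0$ excluded. Moreover this set is positively unbounded: if $(c_1,\ldots,c_m)$ is admissible and $\delta_1,\ldots,\delta_m\ge 0$ are such that $\delta_{j+1}=\delta_j$ whenever $\operatorname{Im}(x_j)>0$, then $(c_1+\delta_1,\ldots,c_m+\delta_m)\in K_1$, i.e. it is again admissible as long as none of its entries is zero. (4) Identifying $V$ with $\mathbb{R}^m$ through the real coefficients and the real and imaginary parts of one coefficient from each conjugate pair, the admissible sets $A_o$ and $A_1$ are each parameterized by a convex subset of $\mathbb{R}^m$ from which the points with some vanishing coefficient are excluded.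
   Context: A vector $(c_1,\ldots,c_m)\in\mathbb{C}^m$ is called conjugation-compatible (with the ordered points $x_1,\ldots,x_m$) if $c_j\in\mathbb{R}$ whenever $x_j\in\mathbb{R}$ and $c_{j+1}=\overline{c_j}$ whenever $\operatorname{Im}(x_j)>0$. A rational function $f(s)$ with real coefficients is positive real if $\operatorname{Re}(f(s))\ge 0$ for all $s$ with $\operatorname{Re}(s)>0$. It is strictly positive real if $f(s-\epsilon)$ is positive real for some $\epsilon>0$. Note that $\Delta_o=\eta/d_o$ and $\Delta_1=\eta/d_1$. *)

(* Defs.v *)
From HB Require Import structures.
From mathcomp Require Import all_boot all_order all_algebra.
From mathcomp Require Import all_classical reals convex complex.

Set Implicit Arguments.
Unset Strict Implicit.
Unset Printing Implicit Defensive.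

Import Order.TTheory GRing.Theory Num.Theory.

Local Open Scope quotient_scope.
Local Open Scope classical_set_scope.
Local Open Scope complex_scope.
Local Open Scope ring_scope.

Notation "p %:F" := (@FracField.tofrac _ p) : ring_scope.

Section RationalFunctions.
Variable R : realType.
Local Notation C := R[i].
Implicit Types (f : {fraction {poly C}}) (s v : C).

Definition real_coef f : Prop :=
  exists p q : {poly C},
    [/\ p \is a polyOver Num.real, q \is a polyOver Num.real, q != 0
      & f = p%:F / q%:F].

(* f is defined at s with value v; removable singularities are filled in
   because p / q may be any representation of f, and no v exists at a pole. *)
Definition has_value f s v : Prop :=
  exists p q : {poly C},
    [/\ q.[s] != 0, f = p%:F / q%:F & v = p.[s] / q.[s]].

(* Substitution f(r(s)), meaningful when r is not constant (it is then
   independent of the chosen representative of f). *)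
Definition frac_comp f (r : {poly C}) : {fraction {poly C}} :=
  (\n_(repr f) \Po r)%:F / (\d_(repr f) \Po r)%:F.

Definition positive_real f : Prop :=
  real_coef f /\
  forall s, 0 < complex.Re s ->
    exists2 v, has_value f s v & 0 <= complex.Re v.

Definition strictly_positive_real f : Prop :=
  exists2 eps : R, 0 < eps & positive_real (frac_comp f ('X - (eps%:C)%:P)).

End RationalFunctions.

Section Interpolation.
Variables (R : realType) (m : nat) (x : 'I_m -> R[i]).
Local Notation C := R[i].
Implicit Types (c : 'rV[C]_m) (S : set 'rV[C]_m).

Definition conj_closed : Prop := forall j, exists k, x k = (x j)^*%C.

Definition conj_ordered : Prop :=
  forall j, 0 < complex.Im (x j) ->
    exists2 k : 'I_m, k = j.+1 :> nat & x k = (x j)^*%C.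

Definition eta_poly : {poly C} := \prod_(j < m) ('X - (x j)%:P).

Definition phi_poly (j : 'I_m) : {poly C} := \prod_(k < m | k != j) ('X - (x k)%:P).

Definition conj_compatible : set 'rV[C]_m :=
  [set c | (forall j, x j \is Num.real -> c 0 j \is Num.real) /\
           (forall j k : 'I_m, 0 < complex.Im (x j) -> k = j.+1 :> nat ->
              c 0 k = (c 0 j)^*%C)].

Definition partial_fractions c : {fraction {poly C}} :=
  \sum_(j < m) (c 0 j)%:P%:F / ('X - (x j)%:P)%:F.

Definition Delta_o c := (partial_fractions c)^-1.
Definition Delta_1 c := (1 + partial_fractions c)^-1.

Definition K_o : set 'rV[C]_m :=
  [set c | [/\ conj_compatible c, \sum_(j < m) c 0 j = 1
             & strictly_positive_real (Delta_o c)]].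

Definition K_1 : set 'rV[C]_m :=
  [set c | conj_compatible c /\ strictly_positive_real (Delta_1 c)].

Definition A_o : set 'rV[C]_m := [set c | K_o c /\ \prod_(j < m) c 0 j != 0].
Definition A_1 : set 'rV[C]_m := [set c | K_1 c /\ \prod_(j < m) c 0 j != 0].

Definition d_o c : {poly C} := \sum_(j < m) c 0 j *: phi_poly j.
Definition d_1 c : {poly C} := eta_poly + \sum_(j < m) c 0 j *: phi_poly j.

(* Over the scalars C the library quantifies over t : C with 0 <= t <= 1; in
   the partial order of R[i] such a t is real, so this is the usual convexity
   of C^m seen as a real vector space. *)
Definition convexC S : Prop := @convex_set C 'rV[C]_m S.

Definition real_subspace S : Prop :=
  S 0 /\ forall (a : R) c c', S c -> S c' -> S (a%:C *: c + c').

(* If Im (x j) < 0 then j > 0 and x j is the conjugate of x (j - 1): the pair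
   contributes the real part of c (j - 1) at position j - 1 and its imaginary
   part at position j. *)
Definition real_coords c : 'rV[R]_m :=
  \row_(j < m) if 0 <= complex.Im (x j) then complex.Re (c 0 j)
               else complex.Im (c 0 (ord_pred j)).

Definition real_linear (h : 'rV[C]_m -> 'rV[R]_m) : Prop :=
  forall (a : R) c c', h (a%:C *: c + c') = a *: h c + h c'.

Definition some_zero : set 'rV[C]_m := [set c | exists j, c 0 j = 0].

End Interpolation.

Arguments some_zero {R m}.

(* Main.v *)
(** A nonzero rational function with nonnegative real part on an open half
    plane has no zero there, because near a zero it would take values with
    negative real part; hence [f] is strictly positive real if and only if
    [1 / f] is.  The conditions defining [K_o] and [K_1] thus become conditions on
    [sum_j c_j / (s - x_j)], which is additive in [c] and has positive real part
    to the right of the [x_j] when the [c_j] are nonnegative.  The coefficients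
    are recovered from [d] by Lagrange interpolation, and they are
    conjugation-compatible exactly when [d] is a real polynomial. *)

Require Import Defs.
From HB Require Import structures.
From mathcomp Require Import all_boot all_order all_algebra.
From mathcomp Require Import all_classical interval_inference reals convex complex.
From mathcomp Require Import polyrcf.

Set Implicit Arguments.
Unset Strict Implicit.
Unset Printing Implicit Defensive.

Import Order.TTheory GRing.Theory Num.Theory.

Local Open Scope classical_set_scope.
Local Open Scope complex_scope.
Local Open Scope ring_scope.

(** * Fractions over an integral domain *)

Section FractionField.
Local Open Scope quotient_scope.
Variable T : idomainType.
Implicit Types (f : {fraction T}) (a b c d : T).

(** Products and inverses in the fraction field are computed on representatives, so the class of a
    ratio is its numerator divided by its denominator. *)
Lemma frac_numden f : f = (\n_(repr f))%:F / (\d_(repr f))%:F.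
Proof.
set u := repr f; rewrite -[f]reprK -/u; unlock FracField.tofrac.
have -> : (\pi_(FracField.type T) (Ratio \d_u 1))^-1 =
    \pi_(FracField.type T) (FracField.invf (Ratio \d_u 1)).
  by rewrite FracField.pi_inv.
rewrite -[RHS]FracField.pi_mul /FracField.mulf /FracField.invf.
by rewrite !numden_Ratio ?oner_eq0 ?denom_ratioP // mulr1 mul1r Ratio_numden.
Qed.

Lemma frac_eq a b c d : b != 0 -> d != 0 ->
  a%:F / b%:F = c%:F / d%:F -> a * d = c * b.
Proof.
move=> b0 d0 /eqP; rewrite eqr_div ?tofrac_eq0 // -!tofracM tofrac_eq.
by move=> /eqP.
Qed.

Lemma eq_frac a b c d : b != 0 -> d != 0 ->
  a * d = c * b -> a%:F / b%:F = c%:F / d%:F.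
Proof.
by move=> b0 d0 e; apply/eqP; rewrite eqr_div ?tofrac_eq0 // -!tofracM e.
Qed.

End FractionField.

(** * Values, substitution and reality of rational functions *)

Section RationalFunctions.
Variable R : realType.
Local Notation C := R[i].
Implicit Types (f g : {fraction {poly C}}) (p q r : {poly C}) (s v : C).

(** Reality becomes a fixed-point condition for a ring morphism, hence is stable under ring
    operations. *)
Lemma polyOver_realE p : (p \is a polyOver Num.real) = (map_poly conjc p == p).
Proof.
apply/polyOverP/eqP => [pR|pE i].
  apply/polyP => i; rewrite coef_map /=.
  by have /complex_realP[a ->] := pR i; rewrite conjc_real.
have : (map_poly conjc p)`_i = p`_i by rewrite pE.
rewrite coef_map /=; case: p`_i => u w [/eqP].
by rewrite eq_sym -addr_eq0 -mulr2n mulrn_eq0 /= complex_real.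
Qed.

Lemma polyOver_realD p q : p \is a polyOver Num.real ->
  q \is a polyOver Num.real -> p + q \is a polyOver Num.real.
Proof. by rewrite !polyOver_realE rmorphD /= => /eqP-> /eqP->. Qed.

Lemma polyOver_realM p q : p \is a polyOver Num.real ->
  q \is a polyOver Num.real -> p * q \is a polyOver Num.real.
Proof. by rewrite !polyOver_realE rmorphM /= => /eqP-> /eqP->. Qed.

Lemma horner_neq0 p s : p.[s] != 0 -> p != 0.
Proof. by apply: contraNneq => ->; rewrite horner0. Qed.

(** Composition with a nonconstant [r] keeps denominators nonzero and respects cross-multiplication,
    so the chosen representative does not matter. *)
Lemma frac_comp_div p q r : (1 < size r)%N -> q != 0 ->
  frac_comp (p%:F / q%:F) r = (p \Po r)%:F / (q \Po r)%:F.
Proof.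
move=> r1 q0; rewrite /frac_comp; set f := p%:F / q%:F.
have d0 := denom_ratioP (repr f).
apply: eq_frac; rewrite ?comp_poly_eq0 //.
by rewrite -!comp_polyM; congr (_ \Po _); apply: frac_eq => //; rewrite -frac_numden.
Qed.

Lemma has_value_comp f r s v : (1 < size r)%N ->
  has_value f r.[s] v -> has_value (frac_comp f r) s v.
Proof.
move=> r1 [p [q [q0 -> ->]]]; exists (p \Po r), (q \Po r).
by rewrite !horner_comp; split => //; rewrite frac_comp_div ?(horner_neq0 q0).
Qed.

Lemma real_coef_comp f r : (1 < size r)%N -> r \is a polyOver Num.real ->
  real_coef f -> real_coef (frac_comp f r).
Proof.
move=> r1 rR [p [q [pR qR q0 ->]]]; exists (p \Po r), (q \Po r).
split; [exact: polyOver_comp| exact: polyOver_comp| |].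
  by rewrite comp_poly_eq0.
by rewrite frac_comp_div.
Qed.

Lemma frac_comp_shiftK f (c : C) :
  frac_comp (frac_comp f ('X - c%:P)) ('X - (- c)%:P) = f.
Proof.
have [p [q [q0 ->]]] : exists p q, q != 0 /\ f = p%:F / q%:F.
  by exists \n_(repr f), \d_(repr f); split; [exact: denom_ratioP|exact: frac_numden].
rewrite !frac_comp_div ?size_XsubC ?comp_poly_eq0 ?size_XsubC //.
have E (u : {poly C}) : (u \Po ('X - c%:P)) \Po ('X - (- c)%:P) = u.
  by rewrite -comp_polyA comp_polyB comp_polyX comp_polyC polyCN opprK addrK comp_polyXr.
by rewrite !E.
Qed.

(** The analytic half of positive realness, on an arbitrary right half plane; requiring a value also
    rules out poles there. *)
Definition Re_ge0_on (a : R) f : Prop :=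
  forall s, a < complex.Re s -> exists2 v, has_value f s v & 0 <= complex.Re v.

(** The shift by [eps] is moved from the argument of the function to the boundary of the half plane,
    so that sums and inverses can be treated without substitution. *)
Lemma strictly_positive_realP f : strictly_positive_real f <->
  real_coef f /\ exists2 eps : R, 0 < eps & Re_ge0_on (- eps) f.
Proof.
have realX (c : R) : 'X - (c%:C)%:P \is a polyOver Num.real.
  by rewrite polyOverXsubC; apply/complex_realP; exists c.
split.
- move=> [eps e0 [fR fP]].
  split.
    rewrite -(frac_comp_shiftK f eps%:C); apply: real_coef_comp => //.
      by rewrite size_XsubC.
    by move: (realX (- eps)); rewrite rmorphN.
  exists eps => // s sP.
  have [|v vP v0] := fP (s + eps%:C).
    by rewrite raddfD /= -ltrBlDr sub0r.
  exists v => //; rewrite -(frac_comp_shiftK f eps%:C); apply: has_value_comp.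
    by rewrite size_XsubC.
  by rewrite hornerXsubC opprK.
- move=> [fR [eps e0 fP]]; exists eps => //; split.
    by apply: real_coef_comp => //; rewrite size_XsubC.
  move=> s s0; have [|v vP v0] := fP (s - eps%:C).
    by rewrite raddfB /= ltrBDr addNr.
  exists v => //; apply: has_value_comp; first by rewrite size_XsubC.
  by rewrite hornerXsubC.
Qed.

Lemma has_value_inj f s v1 v2 : has_value f s v1 -> has_value f s v2 -> v1 = v2.
Proof.
move=> [p [q [q0 -> ->]]] [p' [q' [q'0 e ->]]].
apply/eqP; rewrite eqr_div //.
by rewrite -!hornerM (frac_eq _ _ e) ?(horner_neq0 q0) ?(horner_neq0 q'0).
Qed.

Lemma has_valueD f g s v w : has_value f s v -> has_value g s w ->
  has_value (f + g) s (v + w).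
Proof.
move=> [p [q [q0 -> ->]]] [p' [q' [q'0 -> ->]]].
exists (p * q' + p' * q), (q * q').
split; first by rewrite hornerM mulf_neq0.
  by rewrite addf_div ?tofrac_eq0 ?(horner_neq0 q0) ?(horner_neq0 q'0) // tofracD !tofracM.
by rewrite !hornerE addf_div.
Qed.

Lemma has_valueZ f s v (c : C) : has_value f s v ->
  has_value (c%:P%:F * f) s (c * v).
Proof.
move=> [p [q [q0 -> ->]]]; exists (c *: p), q.
by rewrite hornerZ !mulrA -mul_polyC tofracM.
Qed.

Lemma has_value_div p q s : q.[s] != 0 -> has_value (p%:F / q%:F) s (p.[s] / q.[s]).
Proof. by exists p, q. Qed.

(** * Zeros and inversion of functions with nonnegative real part *)

Lemma Re_mul_real (z : C) (a : R) : complex.Re (z * a%:C) = complex.Re z * a.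
Proof. by case: z => u w; rewrite /= mulr0 subr0. Qed.

Lemma mul_conjcE (z : C) : z * z^*%C = (complex.Re z ^+ 2 + complex.Im z ^+ 2)%:C.
Proof. by case: z => u w; apply/eqP; rewrite eq_complex /= !mulrN opprK -!expr2 [w * u]mulrC addNr !eqxx. Qed.

Lemma sqr_normc_gt0 (z : C) : z != 0 -> 0 < complex.Re z ^+ 2 + complex.Im z ^+ 2.
Proof.
case: z => u w; rewrite eq_complex /= negb_and => /orP[] h.
  by rewrite ltr_pwDl ?sqr_ge0 // exprn_even_gt0.
by rewrite ltr_wpDl ?sqr_ge0 // exprn_even_gt0.
Qed.

Lemma Re_div (a b : C) : b != 0 -> complex.Re (a / b) =
  complex.Re (a * b^*%C) / (complex.Re b ^+ 2 + complex.Im b ^+ 2).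
Proof.
move=> b0; rewrite -Re_mul_real; congr complex.Re.
rewrite (fmorphV (real_complex R)) /= -mul_conjcE invfM mulrA.
by rewrite [a * _ / b]mulrAC mulfK ?conjc_eq0.
Qed.

Lemma Re_inv_ge0 (b : C) : 0 <= complex.Re b -> 0 <= complex.Re b^-1.
Proof.
have [->|b0 hb] := eqVneq b 0; first by rewrite invr0.
rewrite -[b^-1]mul1r Re_div // mul1r divr_ge0 //; last exact/ltW/sqr_normc_gt0.
by case: b hb {b0}.
Qed.

(** Along the real axis, the real part of a complex polynomial is itself a real polynomial; this
    makes continuity of real polynomials applicable. *)
Lemma Re_horner_real p (h : R) :
  complex.Re p.[h%:C] = (map_poly (@complex.Re R) p).[h].
Proof.
rewrite horner_coef raddf_sum (@horner_coef_wide _ (size p)) ?size_poly //.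
by apply: eq_bigr => i _; rewrite -rmorphXn /= Re_mul_real coef_map_id0.
Qed.

(* A zero of order k turns directions by k, so some direction leads into the
   left half plane. *)
Lemma Re_div_lt0_near_root p q s (e : R) : p != 0 -> root p s -> q.[s] != 0 ->
  0 < e -> exists s', [/\ complex.Re s - e < complex.Re s', q.[s'] != 0
    & complex.Re (p.[s'] / q.[s']) < 0].
Proof.
move=> p0 ps qs e0.
have [k [p1]] := multiplicity_XsubC p s; rewrite p0 /= => p1s pE.
have k0 : (0 < k)%N.
  by case: k pE => // pE; rewrite pE expr0 mulr1 (negPf p1s) in ps.
(* The direction [w] satisfies [w ^+ k * p1.[s] / q.[s] = -1], so the leading term of [p / q] at
   [s + h * w] is [- h ^+ k]. *)
pose w : C := k.-root (- (q.[s] / p1.[s])).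
have wk : w ^+ k = - (q.[s] / p1.[s]) by rewrite rootCK.
pose l : {poly C} := w *: 'X + s%:P.
(* Conjugating the coefficients of [q \Po l] conjugates its values at real [h]. Thus [P] at [h] is
   [p / q] at [s + h * w], up to the positive factors [h ^+ k] and the inverse squared modulus of
   [q]; at [0] it equals minus the squared modulus of [q.[s]]. *)
pose P := w ^+ k *: (p1 \Po l) * map_poly conjc (q \Po l).
have PE (h : R) : P.[h%:C] = w ^+ k * p1.[s + h%:C * w] * (q.[s + h%:C * w])^*%C.
  rewrite /P hornerM hornerZ -{2}[h%:C]conjc_real horner_map !horner_comp.
  by rewrite /l !hornerE [w * _]mulrC [_ + s]addrC.
pose rP := map_poly (@complex.Re R) P.
have rP0 : rP.[0] < 0.
  rewrite -Re_horner_real PE mul0r addr0 wk mulNr divfK // mulNr mul_conjcE.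
  by rewrite raddfN /= oppr_lt0 sqr_normc_gt0.
have [d d0 dP] := @poly_cont _ 0 rP (- rP.[0]) ltac:(by rewrite oppr_gt0).
have aw : 0 < 1 + `|complex.Re w| by rewrite ltr_pwDl.
(* The first bound keeps [rP] negative by continuity, the second keeps the real part within [e]; the
   summand [1] in [aw] avoids division by zero. *)
pose h := Num.min (d / 2) (e / (1 + `|complex.Re w|)).
have h0 : 0 < h by rewrite lt_min !divr_gt0.
have hd : h < d by rewrite gt_min ltr_pdivrMr // ltr_pMr // ltr1n.
have he : h * `|complex.Re w| < e.
  have : h * (1 + `|complex.Re w|) <= e by rewrite -ler_pdivlMr // ge_min lexx orbT.
  by apply: lt_le_trans; rewrite mulrDr mulr1 ltrDr.
have rPh : rP.[h] < 0.
  have := dP h; rewrite subr0 gtr0_norm // => /(_ hd) /ltr_normlW.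
  by rewrite ltrBlDr addNr.
(* A zero of [q] at this point would make [P], hence [rP.[h]], vanish. *)
have qh : q.[s + h%:C * w] != 0.
  apply: contraTneq rPh => q0.
  by rewrite -Re_horner_real PE q0 conjc0 mulr0 ltxx.
exists (s + h%:C * w); split => //.
  rewrite raddfD /= ltrD2l mulrC Re_mul_real ltrNl -mulNr.
  apply: le_lt_trans he; by rewrite [_ * h]mulrC ler_pM2l // -normrN ler_norm.
have -> : p.[s + h%:C * w] / q.[s + h%:C * w] =
    w ^+ k * p1.[s + h%:C * w] / q.[s + h%:C * w] * (h ^+ k)%:C.
  rewrite pE hornerM horner_exp hornerXsubC addrAC subrr add0r exprMn rmorphXn.
  by rewrite [RHS]mulrC !mulrA; congr (_ / _); rewrite mulrC !mulrA.
rewrite Re_mul_real Re_div // -PE Re_horner_real.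
by rewrite pmulr_llt0 ?exprn_gt0 // pmulr_llt0 // invr_gt0 sqr_normc_gt0.
Qed.

(** Inversion preserves the sign of the real part of a nonzero value. A zero of a nonzero [f] would
    be a pole of [f^-1], but it cannot occur, since negative real parts would appear nearby. *)
Lemma Re_ge0_on_inv a f : Re_ge0_on a f -> Re_ge0_on a f^-1.
Proof.
move=> fP s sa; have [v [p [q [qs fE vE]]] v0] := fP s sa.
(* The zero function is its own inverse by convention. *)
have [p0|p0] := eqVneq p 0.
  by exists v => //; exists p, q; split=> //; rewrite fE p0 tofrac0 mul0r invr0.
have [ps|ps] := eqVneq p.[s] 0; last first.
  exists v^-1; last exact: Re_inv_ge0.
  by exists q, p; rewrite fE vE !invf_div.
(* The radius [complex.Re s - a] keeps [s'] inside the half plane. *)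
have [|s' [s's qs' neg]] := Re_div_lt0_near_root p0 (introT eqP ps) qs (e := complex.Re s - a).
  by rewrite subr_gt0.
have [|w wP w0] := fP s'; first by move: s's; rewrite opprB addrC subrK.
have wE : w = p.[s'] / q.[s'].
  by apply: has_value_inj wP _; rewrite fE; apply: has_value_div.
by move: neg; rewrite -wE ltNge w0.
Qed.

Lemma real_coef_inv f : real_coef f -> real_coef f^-1.
Proof.
move=> [p [q [pR qR q0 ->]]]; have [->|p0] := eqVneq p 0.
  exists 0, 1; rewrite tofrac0 !mul0r invr0.
  split; [exact: polyOver0|rewrite polyOverC; exact: rpred1|exact: oner_neq0|by []].
by exists q, p; rewrite invf_div.
Qed.

Lemma strictly_positive_real_inv f :
  strictly_positive_real f^-1 <-> strictly_positive_real f.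
Proof.
suff H g : strictly_positive_real g -> strictly_positive_real g^-1.
  by split; [rewrite -{2}[f]invrK|]; exact: H.
move=> /strictly_positive_realP [gR [e e0 gP]]; apply/strictly_positive_realP.
by split; [exact: real_coef_inv|exists e => //; exact: Re_ge0_on_inv].
Qed.

(** * The convex cone of strictly positive real functions *)

Lemma real_coefD f g : real_coef f -> real_coef g -> real_coef (f + g).
Proof.
move=> [p [q [pR qR q0 ->]]] [p' [q' [p'R q'R q'0 ->]]].
exists (p * q' + p' * q), (q * q'); split; last 1 first.
- by rewrite addf_div ?tofrac_eq0 // tofracD !tofracM.
- by apply: polyOver_realD; apply: polyOver_realM.
- exact: polyOver_realM.
- by rewrite mulf_neq0.
Qed.

Lemma real_coefZ f (c : C) : c \is Num.real -> real_coef f -> real_coef (c%:P%:F * f).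
Proof.
move=> cR [p [q [pR qR q0 ->]]]; exists (c *: p), q.
by split => //; [rewrite -mul_polyC polyOver_realM ?polyOverC|rewrite mulrA -tofracM mul_polyC].
Qed.

Lemma Re_ge0_on_le a b f : a <= b -> Re_ge0_on a f -> Re_ge0_on b f.
Proof. by move=> ab fP s sb; apply: fP; apply: le_lt_trans sb. Qed.

Lemma Re_ge0_onD a f g : Re_ge0_on a f -> Re_ge0_on a g -> Re_ge0_on a (f + g).
Proof.
move=> fP gP s sa; have [v vP v0] := fP s sa; have [w wP w0] := gP s sa.
by exists (v + w); [exact: has_valueD|rewrite raddfD addr_ge0].
Qed.

Lemma Re_ge0_onZ a f (c : R) : 0 <= c -> Re_ge0_on a f ->
  Re_ge0_on a ((c%:C)%:P%:F * f).
Proof.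
move=> c0 fP s sa; have [v vP v0] := fP s sa.
by exists (c%:C * v); [exact: has_valueZ|rewrite mulrC Re_mul_real mulr_ge0].
Qed.

Lemma strictly_positive_realD f g : strictly_positive_real f ->
  strictly_positive_real g -> strictly_positive_real (f + g).
Proof.
move=> /strictly_positive_realP [fR [e e0 fP]] /strictly_positive_realP [gR [d d0 gP]].
apply/strictly_positive_realP; split; first exact: real_coefD.
(* The smaller of the two margins works for both summands. *)
exists (Num.min e d); first by rewrite lt_min e0.
by apply: Re_ge0_onD; [apply: Re_ge0_on_le fP|apply: Re_ge0_on_le gP];
  rewrite lerN2 ge_min lexx ?orbT.
Qed.

Lemma strictly_positive_realZ f (c : C) : 0 <= c ->
  strictly_positive_real f -> strictly_positive_real (c%:P%:F * f).
Proof.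
move=> c0 /strictly_positive_realP [fR [e e0 fP]].
have cR := ger0_real c0; apply/strictly_positive_realP; split.
  exact: real_coefZ.
exists e => //; rewrite -(RRe_real cR); apply: Re_ge0_onZ => //.
by rewrite -ler0c RRe_real.
Qed.

End RationalFunctions.

(** * Partial fractions and Lagrange interpolation at the points [x j] *)

Section Lagrange.
Variables (R : realType) (m : nat) (x : 'I_m -> R[i]).
Local Notation C := R[i].
Implicit Types (c : 'rV[C]_m) (p q d : {poly C}).

Lemma monic_eta : eta_poly x \is monic.
Proof. exact: monic_prod_XsubC. Qed.

Lemma size_eta : size (eta_poly x) = m.+1.
Proof. by rewrite size_prod_XsubC /index_enum -enumT size_enum_ord. Qed.

Lemma eta_neq0 : eta_poly x != 0.
Proof. by rewrite -size_poly_eq0 size_eta. Qed.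

Lemma eta_phi j : eta_poly x = ('X - (x j)%:P) * phi_poly x j.
Proof. by rewrite /eta_poly (bigD1 j). Qed.

Lemma horner_eta j : (eta_poly x).[x j] = 0.
Proof. by rewrite (eta_phi j) hornerM hornerXsubC subrr mul0r. Qed.

Lemma monic_phi j : phi_poly x j \is monic.
Proof. exact: monic_prod_XsubC. Qed.

Lemma size_phi j : size (phi_poly x j) = m.
Proof.
have := size_eta; rewrite (eta_phi j) size_monicM ?monicXsubC ?monic_neq0 ?monic_phi //.
by rewrite size_XsubC /= => -[].
Qed.

Lemma horner_phi_neq j k : k != j -> (phi_poly x j).[x k] = 0.
Proof.
move=> kj; rewrite /phi_poly (bigD1 k) //=.
by rewrite hornerM hornerXsubC subrr mul0r.
Qed.

(** Expressing the value through the derivative of [eta_poly x] lets conjugation symmetry of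
    [eta_poly x] carry over to it. *)
Lemma horner_phi j : (phi_poly x j).[x j] = (eta_poly x)^`().[x j].
Proof.
rewrite (eta_phi j) derivM derivXsubC mul1r hornerD hornerM hornerXsubC subrr.
by rewrite mul0r addr0.
Qed.

Lemma horner_phi_neq0 : injective x -> forall j, (phi_poly x j).[x j] != 0.
Proof.
move=> xI j; rewrite horner_prod; apply/prodf_neq0 => k kj.
by rewrite hornerXsubC subr_eq0 (inj_eq xI) eq_sym.
Qed.

Lemma size_d_o c : (size (d_o x c) <= m)%N.
Proof.
apply: (leq_trans (size_sum _ _ _)); apply/bigmax_leqP => j _.
by rewrite (leq_trans (size_scale_leq _ _)) // size_phi.
Qed.

Lemma horner_d_o c j : (d_o x c).[x j] = c 0 j * (phi_poly x j).[x j].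
Proof.
rewrite horner_sum (bigD1 j) //= big1 ?addr0 ?hornerZ // => k kj.
by rewrite hornerZ horner_phi_neq ?mulr0 // eq_sym.
Qed.

Lemma horner_d_1 c j : (d_1 x c).[x j] = c 0 j * (phi_poly x j).[x j].
Proof. by rewrite hornerD horner_eta add0r -horner_d_o. Qed.

(** Every [phi_poly x j] is monic of degree [m.-1]; hence coefficients of sum [1] correspond to
    monic [d_o x c]. *)
Lemma coef_d_o c : (d_o x c)`_m.-1 = \sum_(j < m) c 0 j.
Proof.
rewrite coef_sum; apply: eq_bigr => j _; rewrite coefZ.
have /monicP := monic_phi j; rewrite lead_coefE size_phi => ->.
by rewrite mulr1.
Qed.

Lemma size_d_1 c : size (d_1 x c) = m.+1.
Proof. by rewrite size_polyDl ?size_eta // ltnS size_d_o. Qed.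

Lemma monic_d_1 c : d_1 x c \is monic.
Proof.
rewrite monicE lead_coefDl ?size_eta ?ltnS ?size_d_o // -monicE.
exact: monic_eta.
Qed.

Lemma partial_fractionsE c :
  partial_fractions x c = (d_o x c)%:F / (eta_poly x)%:F.
Proof.
rewrite /d_o rmorph_sum /= mulr_suml; apply: eq_bigr => j _.
have h : phi_poly x j != 0 by rewrite monic_neq0 ?monic_phi.
rewrite (eta_phi j); apply: eq_frac; rewrite ?polyXsubC_eq0 //.
  by rewrite mulf_neq0 ?polyXsubC_eq0.
by rewrite -mul_polyC -mulrA [phi_poly x j * _]mulrC.
Qed.

Lemma Delta_oE c : Delta_o x c = (eta_poly x)%:F / (d_o x c)%:F.
Proof. by rewrite /Delta_o partial_fractionsE invf_div. Qed.

Lemma Delta_1E c : Delta_1 x c = (eta_poly x)%:F / (d_1 x c)%:F.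
Proof.
rewrite /Delta_1 partial_fractionsE -[X in X + _](@divff _ (eta_poly x)%:F).
  by rewrite -mulrDl -tofracD invf_div.
by rewrite tofrac_eq0 eta_neq0.
Qed.

Lemma partial_fractionsD c c' :
  partial_fractions x (c + c') = partial_fractions x c + partial_fractions x c'.
Proof.
rewrite /partial_fractions -big_split; apply: eq_bigr => j _ /=.
by rewrite mxE polyCD tofracD mulrDl.
Qed.

Lemma partial_fractionsZ (a : C) c :
  partial_fractions x (a *: c) = a%:P%:F * partial_fractions x c.
Proof.
rewrite /partial_fractions mulr_sumr; apply: eq_bigr => j _ /=.
by rewrite mxE polyCM tofracM mulrA.
Qed.

(** A nonzero polynomial has fewer roots than its size. Polynomial identities below are checked at
    the [m] points only. *)
Lemma roots_eq0 p : injective x -> (size p <= m)%N ->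
  (forall j, p.[x j] = 0) -> p = 0.
Proof.
move=> xI sp px; apply/eqP/negPn/negP => p0.
have := max_poly_roots p0 (rs := codom x).
rewrite size_codom card_ord ltnNge sp => H; suff: false by [].
apply: H; last by rewrite map_inj_uniq ?enum_uniq.
by apply/allP => _ /codomP[j ->]; apply/eqP/px.
Qed.

(** At distinct points these are the residues of [p / eta_poly x] at its simple poles. *)
Definition lagrange_coords p : 'rV[C]_m := \row_j (p.[x j] / (phi_poly x j).[x j]).

Lemma lagrange_coordsK p : injective x -> (size p <= m)%N -> d_o x (lagrange_coords p) = p.
Proof.
move=> xI sp; apply/eqP; rewrite -subr_eq0; apply/eqP/roots_eq0 => //.
  by rewrite (leq_trans (size_polyD _ _)) // geq_max size_polyN size_d_o.
move=> j; rewrite hornerD hornerN horner_d_o mxE divfK ?subrr //.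
exact: horner_phi_neq0.
Qed.

(** The leading terms cancel, which brings differences of degree [n] monic polynomials within reach
    of interpolation. *)
Lemma size_sub_monic p q n : p \is monic -> q \is monic ->
  size p = n.+1 -> size q = n.+1 -> (size (p - q)%R <= n)%N.
Proof.
move=> /monicP + /monicP; rewrite !lead_coefE => pm qm ps qs.
apply/leq_sizeP => j; rewrite leq_eqVlt => /predU1P[<-|nj].
  by rewrite coefB; move: pm qm; rewrite ps qs /= => -> ->; rewrite subrr.
by rewrite coefB !nth_default ?subrr ?ps ?qs.
Qed.

End Lagrange.

(** * Conjugation symmetry of points, coefficients and polynomials *)

Section Conjugation.
Variables (R : realType) (m : nat) (x : 'I_m -> R[i]).
Local Notation C := R[i].
Implicit Types (c : 'rV[C]_m) (p q d : {poly C}).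
Variables (xI : injective x) (x_conj : conj_closed x) (x_ord : conj_ordered x).

Lemma horner_conjc p z : (map_poly conjc p).[z^*%C] = (p.[z])^*%C.
Proof. exact: horner_map. Qed.

Lemma horner_real_conjc p z : p \is a polyOver Num.real -> p.[z^*%C] = (p.[z])^*%C.
Proof. by rewrite polyOver_realE => /eqP pE; rewrite -horner_conjc pE. Qed.

(** The polynomial and its conjugate are monic of the same degree and both vanish at all [x j],
    since the points are closed under conjugation. *)
Lemma eta_real : eta_poly x \is a polyOver Num.real.
Proof.
have sz : size (map_poly conjc (eta_poly x)) = m.+1 by rewrite size_map_poly size_eta.
rewrite polyOver_realE -subr_eq0; apply/eqP/(roots_eq0 xI).
  by apply: size_sub_monic; rewrite ?map_monic ?monic_eta ?size_eta.
move=> j; have [k xk] := x_conj j.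
rewrite hornerD hornerN horner_eta subr0 -[x j]conjcK -xk horner_conjc.
by rewrite horner_eta conjc0.
Qed.

Lemma horner_phi_conjc j k : x k = (x j)^*%C ->
  (phi_poly x k).[x k] = ((phi_poly x j).[x j])^*%C.
Proof.
move=> xk; rewrite !horner_phi xk; apply: horner_real_conjc.
by have := eta_real; rewrite !polyOver_realE -deriv_map => /eqP ->.
Qed.

(** The conjugate point lies above the axis, so the ordering places its own conjugate right after
    it; distinctness identifies that point with [x j]. *)
Lemma conj_partner j : complex.Im (x j) < 0 ->
  exists k, [/\ 0 < complex.Im (x k), j = k.+1 :> nat & x j = (x k)^*%C].
Proof.
move=> xj; have [k xk] := x_conj j; exists k.
have xk0 : 0 < complex.Im (x k) by rewrite xk; case: (x j) xj => u w /=; rewrite oppr_gt0.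
have [l lk xl] := x_ord xk0; suff <- : l = j by [].
by apply: xI; rewrite xl xk conjcK.
Qed.

(** A symmetric form without index arithmetic: the case [k = j] covers real points, and both
    orientations of a pair are covered. *)
Lemma conj_compatibleP c : conj_compatible x c <->
  forall j k, x k = (x j)^*%C -> c 0 k = (c 0 j)^*%C.
Proof.
split=> [[cR cP]|cP]; last first.
  split=> [j xj|j k xj kj].
    have : c 0 j = (c 0 j)^*%C by apply: cP; move: xj => /complex_realP[a ->]; rewrite conjc_real.
    case: (c 0 j) => u w [/eqP]; rewrite -addr_eq0 -mulr2n mulrn_eq0 /=.
    by rewrite complex_real.
  have [l lj xl] := x_ord xj; apply: cP; rewrite -xl; congr x.
  by apply: val_inj; rewrite /= lj.
have pos j k : 0 < complex.Im (x j) -> x k = (x j)^*%C -> c 0 k = (c 0 j)^*%C.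
  move=> xj xk; have [l lj xl] := x_ord xj.
  have -> : k = l by apply: xI; rewrite xl.
  exact: cP.
move=> j k xk; have [xj|xj|xj] := ltgtP (complex.Im (x j)) 0.
- rewrite -[c 0 k]conjcK; congr conjc; apply/esym/pos; last by rewrite xk conjcK.
  by rewrite xk; case: (x j) xj => u w /=; rewrite oppr_gt0.
- exact: pos.
have xjR : x j \is Num.real by case: (x j) xj => u w /= ->; rewrite complex_real.
have -> : k = j by apply: xI; rewrite xk; move: xjR => /complex_realP[a ->]; rewrite conjc_real.
by have /complex_realP[a ->] := cR j xjR; rewrite conjc_real.
Qed.

(** Both directions compare values at conjugate points, where [d_o x c] takes the value [c 0 j]
    times a nonzero factor that itself respects conjugation. *)
Lemma conj_compatible_d_o c :
  conj_compatible x c <-> d_o x c \is a polyOver Num.real.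
Proof.
split=> [/conj_compatibleP cP|dR].
  rewrite polyOver_realE -subr_eq0; apply/eqP/(roots_eq0 xI).
    by rewrite (leq_trans (size_polyD _ _)) // geq_max size_polyN size_map_poly size_d_o.
  move=> j; have [k xk] := x_conj j; rewrite hornerD hornerN.
  rewrite -{1}[x j]conjcK -xk horner_conjc !horner_d_o (horner_phi_conjc xk) (cP _ _ xk).
  by rewrite rmorphM /= !conjcK subrr.
apply/conj_compatibleP => j k xk.
apply: (mulIf (horner_phi_neq0 xI k)).
rewrite -horner_d_o {1}xk horner_real_conjc // horner_d_o rmorphM /=.
by rewrite (horner_phi_conjc xk).
Qed.

Lemma conj_compatible_d_1 c :
  conj_compatible x c <-> d_1 x c \is a polyOver Num.real.
Proof.
rewrite conj_compatible_d_o !polyOver_realE rmorphD /=.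
have := eta_real; rewrite polyOver_realE => /eqP ->.
by rewrite (inj_eq (addrI _)).
Qed.

Lemma conj_compatible_row (delta : 'I_m -> R) :
  (forall j k : 'I_m, 0 < complex.Im (x j) -> k = j.+1 :> nat -> delta k = delta j) ->
  conj_compatible x (\row_j (delta j)%:C).
Proof.
move=> dP; split=> [j _|j k xj kj]; rewrite !mxE.
  by apply/complex_realP; exists (delta j).
by rewrite (dP j k) // conjc_real.
Qed.

Lemma real_subspace_conj_compatible : real_subspace (conj_compatible x).
Proof.
split=> [|a c c' /conj_compatibleP cP /conj_compatibleP c'P]; apply/conj_compatibleP.
  by move=> j k _; rewrite !mxE conjc0.
move=> j k xk; rewrite !mxE (cP _ _ xk) (c'P _ _ xk).
by rewrite rmorphD rmorphM /= oppr0.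
Qed.

Lemma conj_compatibleD c c' : conj_compatible x c -> conj_compatible x c' ->
  conj_compatible x (c + c').
Proof.
have [_ H] := real_subspace_conj_compatible.
by move=> cP c'P; have := H 1 _ _ cP c'P; rewrite scale1r.
Qed.

Lemma conj_compatibleZ (a : C) c : a \is Num.real -> conj_compatible x c ->
  conj_compatible x (a *: c).
Proof.
move=> /complex_realP[b ->] cP; have [z H] := real_subspace_conj_compatible.
by have := H b _ _ cP z; rewrite addr0.
Qed.

Lemma real_coef_partial_fractions c :
  conj_compatible x c -> real_coef (partial_fractions x c).
Proof.
move=> /conj_compatible_d_o dR; exists (d_o x c), (eta_poly x).
by split; [|exact: eta_real|exact: eta_neq0|exact: partial_fractionsE].
Qed.

(** Each [1 / (s - x j)] has positive real part to the right of [x j], and nonnegative weights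
    preserve the sign. *)
Lemma strictly_positive_real_partial_fractions (x_left : forall j, complex.Re (x j) < 0) c :
  conj_compatible x c -> (forall j, 0 <= c 0 j) ->
  strictly_positive_real (partial_fractions x c).
Proof.
move=> cV c0; apply/strictly_positive_realP; split.
  exact: real_coef_partial_fractions.
(* The margin is the least distance from the points to the imaginary axis, capped at [1]. *)
pose e := \big[Num.min/1]_j (- complex.Re (x j)).
exists e; first by apply: lt_bigmin => // j _; rewrite oppr_gt0.
rewrite /partial_fractions; elim/big_ind: _ => [|f g|j _].
- move=> s _; exists 0 => //; exists 0, 1.
  by split; rewrite ?hornerE ?oner_eq0 ?mul0r // tofrac0 mul0r.
- exact: Re_ge0_onD.
rewrite -(RRe_real (ger0_real (c0 j))); apply: Re_ge0_onZ.
  by rewrite -ler0c RRe_real ?ger0_real.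
move=> s se; have sx : complex.Re (x j) < complex.Re s.
  by apply: le_lt_trans se; rewrite lerNr; exact: bigmin_le.
have sx0 : s - x j != 0.
  by apply: contraTneq sx => /eqP; rewrite subr_eq0 => /eqP ->; rewrite ltxx.
exists (s - x j)^-1.
  by exists 1, ('X - (x j)%:P); split; rewrite ?hornerE ?mul1r.
by rewrite Re_inv_ge0 // raddfB /= subr_ge0 ltW.
Qed.

End Conjugation.

(** * Convexity in terms of explicit weights *)

Section Convexity.
Variables (K : numDomainType) (M : lmodType K).
Implicit Types (S : set M).

Lemma convex_setP S : (forall (t : K) u v, 0 <= t -> 0 <= 1 - t ->
    S u -> S v -> S (t *: u + (1 - t) *: v)) -> @convex_set K M S.
Proof.
move=> SP u v l /set_mem uS /set_mem vS; apply/mem_set.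
by apply: (SP l%:inum) => //; rewrite subr_ge0.
Qed.

End Convexity.

(** * Convexity and nonemptiness of the admissible sets *)

Section AdmissibleSets.
Variables (R : realType) (m : nat) (x : 'I_m -> R[i]).
Local Notation C := R[i].
Implicit Types (c : 'rV[C]_m) (S : set 'rV[C]_m).
Variables (xI : injective x) (x_left : forall j, complex.Re (x j) < 0).
Variables (x_conj : conj_closed x) (x_ord : conj_ordered x).

Lemma strictly_positive_real1 : strictly_positive_real (1 : {fraction {poly C}}).
Proof.
apply/strictly_positive_realP; split.
  have r1 : (1 : {poly C}) \is a polyOver Num.real by rewrite polyOver_realE rmorph1.
  by exists 1, 1; split; rewrite ?oner_neq0 ?divr1.
exists 1 => // s _; exists 1; last exact: ler01.
by exists 1, 1; split; rewrite ?hornerE ?oner_neq0 ?invr1 ?mulr1.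
Qed.

Lemma K_oP c : K_o x c <-> [/\ conj_compatible x c, \sum_(j < m) c 0 j = 1
  & strictly_positive_real (partial_fractions x c)].
Proof. by split=> -[cV c1 /strictly_positive_real_inv cP]. Qed.

Lemma K_1P c : K_1 x c <-> conj_compatible x c /\
  strictly_positive_real (1 + partial_fractions x c).
Proof. by split=> -[cV /strictly_positive_real_inv cP]. Qed.

Lemma conj_compatible_conv (t : C) c c' : 0 <= t -> 0 <= 1 - t ->
  conj_compatible x c -> conj_compatible x c' ->
  conj_compatible x (t *: c + (1 - t) *: c').
Proof.
by move=> t0 t1 cV c'V; apply: conj_compatibleD => //;
  apply: conj_compatibleZ => //; exact: ger0_real.
Qed.

(** After inversion the condition bears on a function linear in [c], so the cone properties
    apply. *)
Lemma K_o_conv (t : C) c c' : 0 <= t -> 0 <= 1 - t ->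
  K_o x c -> K_o x c' -> K_o x (t *: c + (1 - t) *: c').
Proof.
move=> t0 t1 /K_oP[cV c1 cP] /K_oP[c'V c'1 c'P]; apply/K_oP; split.
- exact: conj_compatible_conv.
- under eq_bigr do rewrite !mxE.
  by rewrite big_split /= -!mulr_sumr c1 c'1 !mulr1 addrC subrK.
- rewrite partial_fractionsD !partial_fractionsZ.
  by apply: strictly_positive_realD; apply: strictly_positive_realZ.
Qed.

Lemma K_1_conv (t : C) c c' : 0 <= t -> 0 <= 1 - t ->
  K_1 x c -> K_1 x c' -> K_1 x (t *: c + (1 - t) *: c').
Proof.
move=> t0 t1 /K_1P[cV cP] /K_1P[c'V c'P]; apply/K_1P; split.
  exact: conj_compatible_conv.
(* The constant is split as [t + (1 - t)] because the condition is affine in [c]. *)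
have -> : 1 + partial_fractions x (t *: c + (1 - t) *: c') =
    t%:P%:F * (1 + partial_fractions x c) +
    (1 - t)%:P%:F * (1 + partial_fractions x c').
  rewrite partial_fractionsD !partial_fractionsZ !mulrDr !mulr1 addrACA.
  by rewrite -tofracD -polyCD [t + _]addrC subrK polyC1 tofrac1.
by apply: strictly_positive_realD; apply: strictly_positive_realZ.
Qed.

(** The increment contributes a strictly positive real summand to the inverse of [Delta_1]. *)
Lemma K_1_add c c' : K_1 x c -> conj_compatible x c' -> (forall j, 0 <= c' 0 j) ->
  K_1 x (c + c').
Proof.
move=> /K_1P[cV cP] c'V c'0; apply/K_1P; split; first exact: conj_compatibleD.
rewrite partial_fractionsD addrA; apply: strictly_positive_realD => //.
exact: strictly_positive_real_partial_fractions.
Qed.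

Lemma A_o_neq0 : (0 < m)%N -> A_o x !=set0.
Proof.
move=> m0; have mR : (m%:R : R) != 0 by rewrite pnatr_eq0 -lt0n.
(* Equal positive weights are conjugation-compatible and sum to [1]. *)
pose c : 'rV[C]_m := \row_j (m%:R^-1 : R)%:C.
have cV : conj_compatible x c by apply: conj_compatible_row.
exists c; split.
  apply/K_oP; split => //.
    under eq_bigr do rewrite mxE.
    by rewrite sumr_const card_ord -rmorphMn /= -mulr_natl divff.
  by apply: strictly_positive_real_partial_fractions => // j; rewrite mxE ler0c invr_ge0 ler0n.
apply/prodf_neq0 => j _; rewrite mxE eq_complex /= negb_and.
by rewrite invr_eq0 mR.
Qed.

Lemma A_1_neq0 : A_1 x !=set0.
Proof.
pose c : 'rV[C]_m := \row_j (1 : R)%:C.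
have cV : conj_compatible x c by apply: conj_compatible_row.
exists c; split.
  apply/K_1P; split => //; apply: strictly_positive_realD.
    exact: strictly_positive_real1.
  by apply: strictly_positive_real_partial_fractions => // j; rewrite mxE ler0c ler01.
by apply/prodf_neq0 => j _; rewrite mxE oner_neq0.
Qed.

(** * Excluded hyperplanes and characterization of the denominators *)

Lemma prod_coords_neq0 c : (\prod_(j < m) c 0 j != 0) <-> ~ some_zero c.
Proof.
split=> [/prodf_neq0 c0 [j cj]|c0]; first by have := c0 j isT; rewrite cj eqxx.
by apply/prodf_neq0 => j _; apply/eqP => cj; apply: c0; exists j.
Qed.

Lemma A_oE : A_o x = K_o x `\` some_zero.
Proof. by apply/seteqP; split=> c [Kc /prod_coords_neq0]. Qed.

Lemma A_1E : A_1 x = K_1 x `\` some_zero.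
Proof. by apply/seteqP; split=> c [Kc /prod_coords_neq0]. Qed.

Lemma some_zero_bigcup :
  some_zero = \bigcup_(j : 'I_m) [set c : 'rV[C]_m | c 0 j = 0].
Proof.
by apply/seteqP; split=> [c [j cj]|c [j _ cj]]; exists j.
Qed.

Lemma lagrange_coords_neq0 (d : {poly C}) : (forall j, d.[x j] != 0) ->
  \prod_(j < m) lagrange_coords x d 0 j != 0.
Proof.
move=> dx; apply/prodf_neq0 => j _.
by rewrite mxE mulf_neq0 ?dx // invr_neq0 // horner_phi_neq0.
Qed.

Lemma d_o_image : (0 < m)%N -> [set d_o x c | c in A_o x] =
  [set d : {poly C} |
    [/\ d \is a polyOver Num.real, d \is monic, size d = m,
        (forall j, d.[x j] != 0)
      & strictly_positive_real ((eta_poly x)%:F / d%:F)]].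
Proof.
move=> m0; apply/seteqP; split=> [_ [c [[cV c1 cP] c0] <-]|d [dR dM ds dx dP]] /=.
  (* The coefficient of degree [m.-1] is [1], so the size cannot drop below [m]. *)
  have sz : size (d_o x c) = m.
    apply/eqP; rewrite eqn_leq size_d_o /= leqNgt; apply/negP => sz.
    have := coef_d_o x c; rewrite c1 nth_default.
      by move/esym/eqP; rewrite oner_eq0.
    by rewrite -ltnS prednK.
  split=> //; first exact/conj_compatible_d_o.
  - by apply/monicP; rewrite lead_coefE sz coef_d_o.
  - move=> j; rewrite horner_d_o mulf_neq0 ?horner_phi_neq0 //.
    by move/prodf_neq0 : c0; apply.
  - by rewrite -Delta_oE.
have dE : d_o x (lagrange_coords x d) = d by rewrite lagrange_coordsK ?ds.
exists (lagrange_coords x d) => //; split; last exact: lagrange_coords_neq0.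
split; first by apply/conj_compatible_d_o; rewrite ?dE.
  by rewrite -(coef_d_o x) dE -ds -lead_coefE; apply/monicP.
by rewrite Delta_oE dE.
Qed.

Lemma d_1_image : [set d_1 x c | c in A_1 x] =
  [set d : {poly C} |
    [/\ d \is a polyOver Num.real, d \is monic, size d = m.+1,
        (forall j, d.[x j] != 0)
      & strictly_positive_real ((eta_poly x)%:F / d%:F)]].
Proof.
apply/seteqP; split=> [_ [c [[cV cP] c0] <-]|d [dR dM ds dx dP]] /=.
  split; [exact/conj_compatible_d_1|exact: monic_d_1|exact: size_d_1| |].
  - move=> j; rewrite horner_d_1 mulf_neq0 ?horner_phi_neq0 //.
    by move/prodf_neq0 : c0; apply.
  - by rewrite -Delta_1E.
(* Subtracting [eta_poly x] lowers the degree enough to interpolate and leaves the values at the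
   points unchanged. *)
pose c := lagrange_coords x (d - eta_poly x).
have dE : d_1 x c = d.
  rewrite /d_1 -/(d_o x c) lagrange_coordsK //; first by rewrite addrC subrK.
  by rewrite size_sub_monic ?monic_eta ?size_eta.
exists c => //; split; last first.
  by apply: lagrange_coords_neq0 => j; rewrite hornerD hornerN horner_eta subr0.
by split; [apply/conj_compatible_d_1; rewrite ?dE|rewrite Delta_1E dE].
Qed.

(** * Real coordinates on conjugation-compatible vectors *)

Lemma real_linear_real_coords : real_linear (real_coords x).
Proof.
move=> a c c'; apply/rowP => j; rewrite !mxE.
have mulE (z : C) : a%:C * z = (a * complex.Re z) +i* (a * complex.Im z).
  by case: z => u v; simpc.
by case: ifP => _; rewrite raddfD /= mulE.
Qed.

(** The library predecessor is cyclic; it does not wrap around at a successor index. *)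
Lemma ord_pred_succ (j k : 'I_m) : k = j.+1 :> nat -> ord_pred k = j.
Proof.
move=> kj; apply: val_inj; rewrite /= kj addSn /= modnDr modn_small //.
Qed.

Lemma ordS_succ (j k : 'I_m) : k = j.+1 :> nat -> ordS j = k.
Proof. by move=> kj; apply: val_inj; rewrite /= -kj modn_small. Qed.

(** Coefficients at points on or above the axis are read off directly; those below are conjugates of
    their partners. *)
Lemma real_coords_inj : set_inj (conj_compatible x) (real_coords x).
Proof.
move=> c c' /set_mem cV /set_mem c'V.
move: (cV) (c'V) => /conj_compatibleP cP /conj_compatibleP c'P h.
have E j : 0 <= complex.Im (x j) -> c 0 j = c' 0 j.
  move=> xj; apply/eqP; rewrite eq_complex.
  have := congr1 (fun r : 'rV[R]_m => r 0 j) h; rewrite !mxE xj => ->; rewrite eqxx /=.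
  move: xj; rewrite le_eqVlt => /predU1P[xj|xj].
    have xjR : x j \is Num.real by case: (x j) xj => u w /= <-; rewrite complex_real.
    have /complex_realP[a ->] := cV.1 j xjR.
    by have /complex_realP[b ->] := c'V.1 j xjR.
  have [k kj xk] := x_ord xj.
  have := congr1 (fun r : 'rV[R]_m => r 0 k) h; rewrite !mxE (ord_pred_succ kj).
  case: ifP => [|_ ->//]; rewrite xk leNgt; case: (x j) xj => u w /= w0.
  by rewrite oppr_lt0 w0.
apply/rowP => j; have [xj|xj] := leP 0 (complex.Im (x j)); first exact: E.
have [k [xk _ xjk]] := conj_partner xI x_conj x_ord xj.
by rewrite (cP xI x_ord _ _ xjk) (c'P xI x_ord _ _ xjk) E // ltW.
Qed.

Lemma real_coords_surj :
  set_surj (conj_compatible x) [set: 'rV[R]_m] (real_coords x).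
Proof.
move=> r _.
(* A pair at positions [j] and [j + 1] stores its real part first and its imaginary part second; the
   lower point receives the conjugate. *)
pose c : 'rV[C]_m := \row_j
  if complex.Im (x j) == 0 then (r 0 j)%:C
  else if 0 < complex.Im (x j) then r 0 j +i* r 0 (ordS j)
  else r 0 (ord_pred j) -i* r 0 j.
exists c.
  split=> [j xj|j k xj kj]; rewrite !mxE.
    have -> : complex.Im (x j) == 0.
      by move: xj => /complex_realP[a ->].
    by apply/complex_realP; exists (r 0 j).
  rewrite (gt_eqF xj) xj; have [l lj xl] := x_ord xj.
  have -> : k = l by apply: val_inj; rewrite /= kj lj.
  have xl0 : complex.Im (x l) < 0.
    by rewrite xl; case: (x j) xj => u w /=; rewrite oppr_lt0.
  rewrite (lt_eqF xl0) ltNge (ltW xl0) /= (ord_pred_succ lj) (ordS_succ lj).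
  by [].
apply/rowP => j; rewrite !mxE; have [xj|xj] := leP 0 (complex.Im (x j)).
  move: xj; rewrite le_eqVlt => /predU1P[<-|xj]; first by rewrite eqxx.
  by rewrite gt_eqF // xj.
have [k [xk jk xjk]] := conj_partner xI x_conj x_ord xj.
by rewrite (ord_pred_succ jk) gt_eqF // xk /= (ordS_succ jk).
Qed.

Lemma real_coords_convex S : (forall (t : C) c c', 0 <= t -> 0 <= 1 - t ->
    S c -> S c' -> S (t *: c + (1 - t) *: c')) ->
  @convex_set R 'rV[R]_m (real_coords x @` S).
Proof.
move=> SP; apply: convex_setP => t _ _ t0 t1 [c cS <-] [c' c'S <-].
have rl := real_linear_real_coords.
have rZ a b : real_coords x (a%:C *: b) = a *: real_coords x b.
  (* The combined linearity law with scalar [-1] at zero vectors gives the value at zero, and with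
     it homogeneity. *)
  have r0 : real_coords x 0 = 0.
    by have := rl (-1) 0 0; rewrite scaler0 addr0 scaleN1r addNr.
  by rewrite -[_ *: b]addr0 rl r0 addr0.
exists (t%:C *: c + (1 - t)%:C *: c'); last by rewrite rl rZ.
rewrite rmorphB rmorph1; apply: SP; rewrite ?ler0c //.
by rewrite -(rmorph1 (real_complex R)) -rmorphB ler0c.
Qed.

(** Injectivity on compatible vectors lets the image commute with the set difference. *)
Lemma real_coords_setD S : S `<=` conj_compatible x ->
  real_coords x @` (S `\` some_zero) = (real_coords x @` S) `\`
    (real_coords x @` (conj_compatible x `&` some_zero)).
Proof.
move=> SV; apply/seteqP; split=> [_ [c [Sc c0] <-]|_ [[c Sc <-] c0]].
  split; first by exists c.
  move=> [c' [c'V c'0]] e; apply: c0; suff <- : c' = c by [].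
  by apply: real_coords_inj => //; apply/mem_set => //; apply: SV.
exists c => //; split => // cz; apply: c0; exists c => //.
by split => //; apply: SV.
Qed.

End AdmissibleSets.

Theorem theorem2p11 (R : realType) (m : nat) (x : 'I_m -> R[i])
  (m_gt0 : (0 < m)%N)
  (x_distinct : injective x)
  (x_left : forall j, complex.Re (x j) < 0)
  (x_conj : conj_closed x)
  (x_ord : conj_ordered x) :
  (* (1) *)
  [/\ A_o x !=set0, A_1 x !=set0,
      [set d_o x c | c in A_o x] =
        [set d : {poly R[i]} |
          [/\ d \is a polyOver Num.real, d \is monic, size d = m,
              (forall j, d.[x j] != 0)
            & strictly_positive_real ((eta_poly x)%:F / d%:F)]]
    & [set d_1 x c | c in A_1 x] =
        [set d : {poly R[i]} |
          [/\ d \is a polyOver Num.real, d \is monic, size d = m.+1,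
              (forall j, d.[x j] != 0)
            & strictly_positive_real ((eta_poly x)%:F / d%:F)]]] /\
  (* (2) *)
  [/\ convexC (K_o x),
      K_o x `<=` [set c : 'rV[R[i]]_m | \sum_(j < m) c 0 j = 1]
    & A_o x = K_o x `\` some_zero] /\
  (* (3) *)
  [/\ convexC (K_1 x),
      A_1 x = K_1 x `\` \bigcup_(j : 'I_m) [set c : 'rV[R[i]]_m | c 0 j = 0]
    & forall (c : 'rV[R[i]]_m) (delta : 'I_m -> R),
        A_1 x c ->
        (forall j, 0 <= delta j) ->
        (forall j k : 'I_m, 0 < complex.Im (x j) -> k = j.+1 :> nat ->
           delta k = delta j) ->
        let c' := c + \row_j (delta j)%:C in
        K_1 x c' /\ ((forall j, c' 0 j != 0) -> A_1 x c')] /\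
  (* (4) *)
  [/\ real_subspace (conj_compatible x) /\ real_linear (real_coords x),
      set_bij (conj_compatible x) [set: 'rV[R]_m] (real_coords x),
      @convex_set R 'rV[R]_m (real_coords x @` K_o x) /\
      real_coords x @` A_o x = (real_coords x @` K_o x) `\`
        (real_coords x @` (conj_compatible x `&` some_zero))
    & @convex_set R 'rV[R]_m (real_coords x @` K_1 x) /\
      real_coords x @` A_1 x = (real_coords x @` K_1 x) `\`
        (real_coords x @` (conj_compatible x `&` some_zero))].
Proof.
split; first by split; [exact: A_o_neq0|exact: A_1_neq0|exact: d_o_image|exact: d_1_image].
split.
  split; [|by move=> c []|exact: A_oE].
  by apply: convex_setP => t c c'; exact: K_o_conv.
split.
  split; [by apply: convex_setP => t c c'; exact: K_1_conv|by rewrite A_1E some_zero_bigcup|].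
  move=> c delta [Kc _] d0 dP c'.
  have Kc' : K_1 x c'.
    apply: K_1_add => //; first exact: conj_compatible_row.
    by move=> j; rewrite mxE ler0c.
  by split=> // c'0; split=> //; apply/prodf_neq0 => j _.
split.
- by split; [exact: real_subspace_conj_compatible|exact: real_linear_real_coords].
- by split; [|exact: real_coords_inj|exact: real_coords_surj].
- split; first by apply: real_coords_convex; exact: K_o_conv.
  by rewrite A_oE real_coords_setD // => c [].
- split; first by apply: real_coords_convex; exact: K_1_conv.
  by rewrite A_1E real_coords_setD // => c [].
Qed.
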